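(* The category $\mathsf{ELHSLat}$ of equationally linear Heyting semilattices is not cosmash associative.
   Context: A Heyting semilattice $(H,1,\wedge,\to)$ is a meet-semilattice with top element $1$ and a binary operation $\to$ such that $x\wedge y\leq z$ if and only if $x\leq y\to z$. Morphisms preserve $1$, $\wedge$ and $\to$. It is equationally linear when it satisfies $((x\to y)\to z)\wedge((y\to x)\to z)=z$. $\mathsf{ELHSLat}$ is the variety (category) of equationally linear Heyting semilattices and their morphisms; its zero object is $\{1\}$, so the kernel of $f$ is $f^{-1}(1)$. In a semi-abelian category (pointed, with finite limits and coproducts), the binary cosmash product $X\diamond Y$ is the kernel of the canonical morphism $X+Y\to X\times Y$ with components $\langle 1_X,0\rangle$ and $\langle 0,1_Y\rangle$. The ternary cosmash product $X\diamond Y\diamond Z$ is the kernel of the canonical morphism $X+Y+Z\to (X+Y)\times(X+Z)\times(Y+Z)$ whose three components are induced by sending, respectively, $Z$, $Y$ and $X$ to zero. The composite $(X\diamond Y)\diamond Z\rightarrowtail (X\diamond Y)+Z\to X+Y+Z$ (the second morphism being induced by the inclusion $X\diamond Y\rightarrowtail X+Y$ and the identity on $Z$) factors through $X\diamond Y\diamond Z$, giving a canonical comparison morphism $c\colon (X\diamond Y)\diamond Z\to X\diamond Y\diamond Z$. The category is called cosmash associative when $c$ is an isomorphism for all objects $X$, $Y$, $Z$. *)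

(* Defs.v *)
From HB Require Import structures.
From mathcomp Require Import all_boot all_order.
From mathcomp Require Import boolp.

Set Implicit Arguments.
Unset Strict Implicit.
Unset Printing Implicit Defensive.

Import Order.TTheory.

(* Homs are compared with Leibniz equality; [comp g f] is "g after f". *)
Record category := Category {
  obj :> Type;
  hom : obj -> obj -> Type;
  idm : forall X, hom X X;
  comp : forall X Y Z, hom Y Z -> hom X Y -> hom X Z;
  comp1m : forall X Y (f : hom X Y), comp (idm Y) f = f;
  compm1 : forall X Y (f : hom X Y), comp f (idm X) = f;
  compmA : forall W X Y Z (h : hom Y Z) (g : hom X Y) (f : hom W X),
    comp h (comp g f) = comp (comp h g) f }.

Arguments idm {c} X.
Arguments comp {c X Y Z} g f.

Declare Scope cat_scope.
Delimit Scope cat_scope with cat.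
Local Open Scope cat_scope.
Notation "g \c f" := (comp g f) (at level 40, left associativity) : cat_scope.

(* A category with a zero object, binary products and equalizers (hence all
   finite limits), and binary coproducts, all of them chosen. *)
Record ptCategory := PtCategory {
  cat :> category;
  zobj : cat;
  to_zobj : forall X : cat, hom X zobj;
  from_zobj : forall X : cat, hom zobj X;
  to_zobj_uniq : forall (X : cat) (f : hom X zobj), f = to_zobj X;
  from_zobj_uniq : forall (X : cat) (f : hom zobj X), f = from_zobj X;
  prodo : cat -> cat -> cat;
  proj1 : forall X Y, hom (prodo X Y) X;
  proj2 : forall X Y, hom (prodo X Y) Y;
  pairm : forall W X Y, hom W X -> hom W Y -> hom W (prodo X Y);
  proj1_pair : forall W X Y (f : hom W X) (g : hom W Y),
    proj1 X Y \c pairm f g = f;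
  proj2_pair : forall W X Y (f : hom W X) (g : hom W Y),
    proj2 X Y \c pairm f g = g;
  pair_uniq : forall W X Y (h : hom W (prodo X Y)),
    h = pairm (proj1 X Y \c h) (proj2 X Y \c h);
  eqlz : forall X Y : cat, hom X Y -> hom X Y -> cat;
  eqlzm : forall (X Y : cat) (f g : hom X Y), hom (eqlz f g) X;
  eqlz_lift : forall (W X Y : cat) (f g : hom X Y) (h : hom W X),
    f \c h = g \c h -> hom W (eqlz f g);
  eqlzE : forall (X Y : cat) (f g : hom X Y), f \c eqlzm f g = g \c eqlzm f g;
  eqlz_liftK : forall (W X Y : cat) (f g : hom X Y) (h : hom W X)
    (e : f \c h = g \c h), eqlzm f g \c eqlz_lift e = h;
  eqlzm_mono : forall (W X Y : cat) (f g : hom X Y) (h k : hom W (eqlz f g)),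
    eqlzm f g \c h = eqlzm f g \c k -> h = k;
  sumo : cat -> cat -> cat;
  inj1 : forall X Y, hom X (sumo X Y);
  inj2 : forall X Y, hom Y (sumo X Y);
  copair : forall X Y Z, hom X Z -> hom Y Z -> hom (sumo X Y) Z;
  copair_inj1 : forall X Y Z (f : hom X Z) (g : hom Y Z),
    copair f g \c inj1 X Y = f;
  copair_inj2 : forall X Y Z (f : hom X Z) (g : hom Y Z),
    copair f g \c inj2 X Y = g;
  copair_uniq : forall X Y Z (h : hom (sumo X Y) Z),
    h = copair (h \c inj1 X Y) (h \c inj2 X Y) }.

Arguments proj1 {p} X Y.
Arguments proj2 {p} X Y.
Arguments pairm {p W X Y} f g.
Arguments eqlz {p X Y} f g.
Arguments eqlzm {p X Y} f g.
Arguments eqlz_lift {p W X Y f g h}.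
Arguments inj1 {p X Y}.
Arguments inj2 {p X Y}.
Arguments copair {p X Y Z} f g.

Section Cosmash.
Variable C : ptCategory.
Implicit Types W X Y Z : C.

Definition is_iso X Y (f : hom X Y) :=
  exists g : hom Y X, g \c f = idm X /\ f \c g = idm Y.

Definition zerom X Y : hom X Y := from_zobj Y \c to_zobj X.

Lemma comp0m X Y Z (f : hom X Y) : zerom Y Z \c f = zerom X Z.
Proof. by rewrite /zerom -compmA; congr comp; exact: to_zobj_uniq. Qed.

Lemma compm0 X Y Z (f : hom Y Z) : f \c zerom X Y = zerom X Z.
Proof. by rewrite /zerom compmA; congr comp; exact: from_zobj_uniq. Qed.

Lemma pair_comp V W X Y (f : hom W X) (g : hom W Y) (h : hom V W) :
  pairm f g \c h = pairm (f \c h) (g \c h).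
Proof. by rewrite [LHS]pair_uniq !compmA proj1_pair proj2_pair. Qed.

Lemma copair_comp X Y Z W (f : hom X Z) (g : hom Y Z) (h : hom Z W) :
  h \c copair f g = copair (h \c f) (h \c g).
Proof. by rewrite [LHS]copair_uniq -!compmA copair_inj1 copair_inj2. Qed.

Definition kerob X Y (f : hom X Y) : C := eqlz f (zerom X Y).
Definition kerm X Y (f : hom X Y) : hom (kerob f) X := eqlzm f (zerom X Y).

Lemma kermE X Y (f : hom X Y) : f \c kerm f = zerom _ _.
Proof. by rewrite /kerm eqlzE comp0m. Qed.

Lemma ker_liftP W X Y (f : hom X Y) (h : hom W X) :
  f \c h = zerom W Y -> f \c h = zerom X Y \c h.
Proof. by rewrite comp0m. Qed.

Definition ker_lift W X Y (f : hom X Y) (h : hom W X)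
  (fh0 : f \c h = zerom W Y) : hom W (kerob f) := eqlz_lift (ker_liftP fh0).

Definition sum_to_prod X Y : hom (sumo X Y) (prodo X Y) :=
  copair (pairm (idm X) (zerom X Y)) (pairm (zerom Y X) (idm Y)).

Definition cosmash X Y : C := kerob (sum_to_prod X Y).
Definition cosmashm X Y : hom (cosmash X Y) (sumo X Y) :=
  kerm (sum_to_prod X Y).

(* X + Y + Z is bracketed as (X + Y) + Z; the components of [sum3_to_prod]
   kill Z, Y and X respectively. *)
Definition kill3 X Y Z : hom (sumo (sumo X Y) Z) (sumo X Y) :=
  copair (idm (sumo X Y)) (zerom Z (sumo X Y)).
Definition kill2 X Y Z : hom (sumo (sumo X Y) Z) (sumo X Z) :=
  copair (copair inj1 (zerom Y (sumo X Z))) inj2.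
Definition kill1 X Y Z : hom (sumo (sumo X Y) Z) (sumo Y Z) :=
  copair (copair (zerom X (sumo Y Z)) inj1) inj2.

Definition sum3_to_prod X Y Z :
  hom (sumo (sumo X Y) Z) (prodo (prodo (sumo X Y) (sumo X Z)) (sumo Y Z)) :=
  pairm (pairm (kill3 X Y Z) (kill2 X Y Z)) (kill1 X Y Z).

Definition cosmash3 X Y Z : C := kerob (sum3_to_prod X Y Z).
Definition cosmash3m X Y Z : hom (cosmash3 X Y Z) (sumo (sumo X Y) Z) :=
  kerm (sum3_to_prod X Y Z).

(* (X <> Y) <> Z -> (X <> Y) + Z -> X + Y + Z *)
Definition cosmash2m X Y Z :
    hom (cosmash (cosmash X Y) Z) (sumo (sumo X Y) Z) :=
  copair (inj1 \c cosmashm X Y) inj2 \c cosmashm (cosmash X Y) Z.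

Lemma cosmash_copair0 X Y Z (f : hom X Z) :
  copair f (zerom Y Z) \c cosmashm X Y = zerom _ _.
Proof.
have -> : copair f (zerom Y Z) = f \c proj1 X Y \c sum_to_prod X Y.
  by rewrite /sum_to_prod copair_comp -!compmA !proj1_pair compm1 compm0.
by rewrite -compmA kermE compm0.
Qed.

Lemma cosmash_copair0l X Y Z (g : hom Y Z) :
  copair (zerom X Z) g \c cosmashm X Y = zerom _ _.
Proof.
have -> : copair (zerom X Z) g = g \c proj2 X Y \c sum_to_prod X Y.
  by rewrite /sum_to_prod copair_comp -!compmA !proj2_pair compm1 compm0.
by rewrite -compmA kermE compm0.
Qed.

Lemma pair00 W X Y : pairm (zerom W X) (zerom W Y) = zerom W (prodo X Y).
Proof. by rewrite [RHS]pair_uniq !compm0. Qed.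

Lemma cosmash2m_ker X Y Z : sum3_to_prod X Y Z \c cosmash2m X Y Z = zerom _ _.
Proof.
have k3 : kill3 X Y Z \c cosmash2m X Y Z = zerom _ _.
  rewrite /cosmash2m /kill3 compmA copair_comp compmA copair_inj1 copair_inj2.
  by rewrite cosmash_copair0.
have k2 : kill2 X Y Z \c cosmash2m X Y Z = zerom _ _.
  rewrite /cosmash2m /kill2 compmA copair_comp compmA copair_inj1 copair_inj2.
  by rewrite cosmash_copair0 cosmash_copair0l.
have k1 : kill1 X Y Z \c cosmash2m X Y Z = zerom _ _.
  rewrite /cosmash2m /kill1 compmA copair_comp compmA copair_inj1 copair_inj2.
  by rewrite !cosmash_copair0l.
by rewrite /sum3_to_prod !pair_comp k3 k2 k1 !pair00.
Qed.

Definition cosmash_comparison X Y Z :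
    hom (cosmash (cosmash X Y) Z) (cosmash3 X Y Z) :=
  ker_lift (cosmash2m_ker X Y Z).

Definition cosmash_associative :=
  forall X Y Z, is_iso (cosmash_comparison X Y Z).

End Cosmash.

HB.mixin Record hasHeytingImp d T of Order.TMeetSemilattice d T := {
  himp : T -> T -> T;
  lexhimp : forall x y z : T, (Order.meet x y <= z)%O = (x <= himp y z)%O
}.

#[short(type="heytingSemilatticeType")]
HB.structure Definition HeytingSemilattice d :=
  { T of Order.TMeetSemilattice d T & hasHeytingImp d T }.

HB.mixin Record HeytingSemilattice_isEqLinear d T
    of HeytingSemilattice d T := {
  himp_lin : forall x y z : T,
    Order.meet (himp (himp x y) z) (himp (himp y x) z) = z
}.

#[short(type="elhsType")]
HB.structure Definition ELHSemilattice d :=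
  { T of HeytingSemilattice d T & HeytingSemilattice_isEqLinear d T }.

HB.factory Record isELHSemilattice (d : Order.disp_t) T of Choice T := {
  top : T;
  meet : T -> T -> T;
  imp : T -> T -> T;
  meetA : associative meet;
  meetC : commutative meet;
  meetxx : idempotent_op meet;
  meet1x : left_id top meet;
  meet_imp : forall x y z,
    meet (meet x y) z = meet x y <-> meet x (imp y z) = x;
  imp_lin : forall x y z,
    meet (imp (imp x y) z) (imp (imp y x) z) = z
}.

HB.builders Context d T of isELHSemilattice d T.

Let le x y := meet x y == x.

Let le_refl : reflexive le.
Proof. by move=> x; rewrite /le meetxx. Qed.

Let le_anti : antisymmetric le.
Proof. by move=> x y /andP[/eqP xy /eqP yx]; rewrite -xy meetC yx. Qed.

Let le_trans : transitive le.
Proof.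
by move=> y x z /eqP xy /eqP yz; apply/eqP; rewrite -xy -meetA yz.
Qed.

HB.instance Definition _ :=
  Order.Le_isPOrder.Build d T le_refl le_anti le_trans.

Let leEmeet (x y : T) : (x <= y)%O = (meet x y == x).
Proof. by []. Qed.

HB.instance Definition _ :=
  Order.POrder_Meet_isSemilattice.Build d T meetC meetA leEmeet.

Let lex1 (x : T) : (x <= top)%O.
Proof. by rewrite leEmeet meetC meet1x. Qed.

HB.instance Definition _ := Order.hasTop.Build d T lex1.

Let lexhimp (x y z : T) : (Order.meet x y <= z)%O = (x <= imp y z)%O.
Proof. by rewrite !leEmeet; apply/eqP/eqP => /meet_imp. Qed.

HB.instance Definition _ := hasHeytingImp.Build d T lexhimp.
HB.instance Definition _ := HeytingSemilattice_isEqLinear.Build d T imp_lin.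

HB.end.

(* Order displays only control printing, so fixing one is harmless. *)
Definition elhs_display : Order.disp_t := Order.Disp tt tt.
Notation elhs := (elhsType elhs_display).

Lemma himp_meetE d (T : heytingSemilatticeType d) (x y z : T) :
  Order.meet (Order.meet x y) z = Order.meet x y <->
  Order.meet x (himp y z) = x.
Proof.
split=> /eqP; rewrite -leEmeet; first by rewrite lexhimp leEmeet => /eqP.
by rewrite -lexhimp leEmeet => /eqP.
Qed.

Record elhs_hom (X Y : elhs) := ElhsHom {
  elhs_fun :> X -> Y;
  elhs_fun1 : elhs_fun Order.top = Order.top;
  elhs_funM : {morph elhs_fun : x y / Order.meet x y};
  elhs_funI : {morph elhs_fun : x y / himp x y} }.

Lemma elhs_homP (X Y : elhs) (f g : elhs_hom X Y) : f =1 g -> f = g.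
Proof.
case: f g => f f1 fM fI [g g1 gM gI] /= /funext fg.
by move: f1 fM fI; rewrite fg => f1 fM fI; congr ElhsHom.
Qed.

Definition elhs_id (X : elhs) : elhs_hom X X.
Proof. by exists id. Defined.

Definition elhs_comp (X Y Z : elhs) (g : elhs_hom Y Z) (f : elhs_hom X Y) :
  elhs_hom X Z.
Proof.
exists (g \o f) => [|x y|x y] /=; first by rewrite !elhs_fun1.
- by rewrite !elhs_funM.
- by rewrite !elhs_funI.
Defined.

Definition ELHS_category : category.
Proof.
exists elhs elhs_hom elhs_id elhs_comp.
- by move=> X Y f; apply: elhs_homP.
- by move=> X Y f; apply: elhs_homP.
- by move=> W X Y Z h g f; apply: elhs_homP.
Defined.

Section Zero.

Definition elhs_unit := unit.
HB.instance Definition _ := Choice.on elhs_unit.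

Let op (_ _ : elhs_unit) : elhs_unit := tt.

#[local] Lemma unitE (x y : elhs_unit) : x = y.
Proof. by case: x y => -[]. Qed.

HB.instance Definition _ := @isELHSemilattice.Build elhs_display elhs_unit
  tt op op (fun _ _ _ => unitE _ _) (fun _ _ => unitE _ _)
  (fun _ => unitE _ _) (fun _ => unitE _ _)
  (fun _ _ _ => conj (fun _ => unitE _ _) (fun _ => unitE _ _))
  (fun _ _ _ => unitE _ _).

Definition elhs_to_unit (X : elhs) : elhs_hom X elhs_unit.
Proof. by exists (fun=> tt). Defined.

Definition elhs_from_unit (X : elhs) : elhs_hom elhs_unit X.
Proof.
exists (fun=> Order.top) => [//|x y|x y]; first by rewrite meetxx.
by apply/esym/eqP; rewrite eq_le lex1 -lexhimp lex1.
Defined.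

End Zero.

Section Product.
Variables X Y : elhs.

Definition elhs_prod := (X * Y)%type.
HB.instance Definition _ := Choice.on elhs_prod.
Implicit Types u v w : elhs_prod.

Let top : elhs_prod := (Order.top, Order.top).
Let meet u v : elhs_prod := (Order.meet u.1 v.1, Order.meet u.2 v.2).
Let imp u v : elhs_prod := (himp u.1 v.1, himp u.2 v.2).

Let prodA : associative meet.
Proof. by move=> u v w; congr pair; apply: meetA. Qed.
Let prodC : commutative meet.
Proof. by move=> u v; congr pair; apply: meetC. Qed.
Let prodxx : idempotent_op meet.
Proof. by move=> [x y]; congr pair; apply: meetxx. Qed.
Let prod1x : left_id top meet.
Proof. by move=> [x y]; congr pair; apply: meet1x. Qed.
Let prod_imp u v w : meet (meet u v) w = meet u v <-> meet u (imp v w) = u.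
Proof.
case: u v w => [u1 u2] [v1 v2] [w1 w2].
by split=> -[e1 e2]; congr pair; apply/himp_meetE.
Qed.
Let prod_lin u v w : meet (imp (imp u v) w) (imp (imp v u) w) = w.
Proof. by case: w => w1 w2; congr pair; apply: himp_lin. Qed.

HB.instance Definition _ := @isELHSemilattice.Build elhs_display elhs_prod
  top meet imp prodA prodC prodxx prod1x prod_imp prod_lin.

Definition elhs_proj1 : elhs_hom elhs_prod X.
Proof. by exists (fun u : elhs_prod => u.1). Defined.

Definition elhs_proj2 : elhs_hom elhs_prod Y.
Proof. by exists (fun u : elhs_prod => u.2). Defined.

Definition elhs_pair (W : elhs) (f : elhs_hom W X) (g : elhs_hom W Y) :
  elhs_hom W elhs_prod.
Proof.
exists (fun a : W => (f a, g a) : elhs_prod) => [|x y|x y].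
- by rewrite !elhs_fun1.
- by rewrite !elhs_funM.
- by rewrite !elhs_funI.
Defined.

End Product.

Section Equalizer.
Variables (X Y : elhs) (f g : elhs_hom X Y).

Definition elhs_eqlz := {x : X | f x == g x}.
HB.instance Definition _ := SubChoice.on elhs_eqlz.
Implicit Types u v w : elhs_eqlz.

Let topP : f Order.top == g Order.top.
Proof. by rewrite !elhs_fun1. Qed.
Let meetP u v :
  f (Order.meet (val u) (val v)) == g (Order.meet (val u) (val v)).
Proof. by rewrite !elhs_funM (eqP (valP u)) (eqP (valP v)). Qed.
Let impP u v : f (himp (val u) (val v)) == g (himp (val u) (val v)).
Proof. by rewrite !elhs_funI (eqP (valP u)) (eqP (valP v)). Qed.

Let top : elhs_eqlz := exist (fun x : X => f x == g x) _ topP.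
Let meet u v : elhs_eqlz := exist (fun x : X => f x == g x) _ (meetP u v).
Let imp u v : elhs_eqlz := exist (fun x : X => f x == g x) _ (impP u v).

Let eqlzA : associative meet.
Proof. by move=> u v w; apply: val_inj; apply: meetA. Qed.
Let eqlzC : commutative meet.
Proof. by move=> u v; apply: val_inj; apply: meetC. Qed.
Let eqlzxx : idempotent_op meet.
Proof. by move=> u; apply: val_inj; apply: meetxx. Qed.
Let eqlz1x : left_id top meet.
Proof. by move=> u; apply: val_inj; apply: meet1x. Qed.
Let eqlz_imp u v w : meet (meet u v) w = meet u v <-> meet u (imp v w) = u.
Proof.
by split=> /(congr1 val) /= /himp_meetE e; apply: val_inj.
Qed.
Let eqlz_lin u v w : meet (imp (imp u v) w) (imp (imp v u) w) = w.
Proof. by apply: val_inj; apply: himp_lin. Qed.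

HB.instance Definition _ := @isELHSemilattice.Build elhs_display elhs_eqlz
  top meet imp eqlzA eqlzC eqlzxx eqlz1x eqlz_imp eqlz_lin.

Definition elhs_eqlzm : elhs_hom elhs_eqlz X.
Proof. by exists (fun u : elhs_eqlz => val u). Defined.

Lemma elhs_eqlz_liftP (W : elhs) (h : elhs_hom W X) :
  elhs_comp f h = elhs_comp g h -> forall a : W, f (h a) == g (h a).
Proof. by move=> fh a; apply/eqP/(congr1 (fun k : elhs_hom W Y => k a) fh). Qed.

Definition elhs_eqlz_lift (W : elhs) (h : elhs_hom W X)
  (fh : elhs_comp f h = elhs_comp g h) : elhs_hom W elhs_eqlz.
Proof.
exists (fun a : W => exist (fun x : X => f x == g x) _
  (elhs_eqlz_liftP fh a) : elhs_eqlz) => [|x y|x y]; apply: val_inj; rewrite /=.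
- exact: elhs_fun1.
- exact: elhs_funM.
- exact: elhs_funI.
Defined.

End Equalizer.

(* The coproduct: terms over the disjoint union of X and Y, modulo the least
   congruence making the quotient an equationally linear Heyting semilattice
   and both inclusions homomorphisms. *)
Section Coproduct.
Variables X Y : elhs.

Inductive sum_term : Type :=
| TInl of X
| TInr of Y
| TTop
| TMeet of sum_term & sum_term
| TImp of sum_term & sum_term.

HB.instance Definition _ := gen_eqMixin sum_term.
HB.instance Definition _ := gen_choiceMixin sum_term.

Inductive sum_cong : sum_term -> sum_term -> Prop :=
| SC_refl s : sum_cong s s
| SC_sym s t : sum_cong s t -> sum_cong t s
| SC_trans s t r : sum_cong s t -> sum_cong t r -> sum_cong s r
| SC_meet s s' t t' : sum_cong s s' -> sum_cong t t' ->
    sum_cong (TMeet s t) (TMeet s' t')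
| SC_imp s s' t t' : sum_cong s s' -> sum_cong t t' ->
    sum_cong (TImp s t) (TImp s' t')
| SC_meetA s t r : sum_cong (TMeet s (TMeet t r)) (TMeet (TMeet s t) r)
| SC_meetC s t : sum_cong (TMeet s t) (TMeet t s)
| SC_meetxx s : sum_cong (TMeet s s) s
| SC_meet1x s : sum_cong (TMeet TTop s) s
| SC_adj1 s t r : sum_cong (TMeet (TMeet s t) r) (TMeet s t) ->
    sum_cong (TMeet s (TImp t r)) s
| SC_adj2 s t r : sum_cong (TMeet s (TImp t r)) s ->
    sum_cong (TMeet (TMeet s t) r) (TMeet s t)
| SC_lin s t r :
    sum_cong (TMeet (TImp (TImp s t) r) (TImp (TImp t s) r)) r
| SC_inl1 : sum_cong (TInl Order.top) TTop
| SC_inlM x x' : sum_cong (TInl (Order.meet x x')) (TMeet (TInl x) (TInl x'))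
| SC_inlI x x' : sum_cong (TInl (himp x x')) (TImp (TInl x) (TInl x'))
| SC_inr1 : sum_cong (TInr Order.top) TTop
| SC_inrM y y' : sum_cong (TInr (Order.meet y y')) (TMeet (TInr y) (TInr y'))
| SC_inrI y y' : sum_cong (TInr (himp y y')) (TImp (TInr y) (TInr y')).

Definition sum_congb (s t : sum_term) : bool := `[< sum_cong s t >].

Lemma sum_congb_refl : reflexive sum_congb.
Proof. by move=> s; apply/asboolP; apply: SC_refl. Qed.
Lemma sum_congb_sym : symmetric sum_congb.
Proof. by move=> s t; apply/asboolP/asboolP; apply: SC_sym. Qed.
Lemma sum_congb_trans : transitive sum_congb.
Proof.
by move=> t s r /asboolP st /asboolP tr; apply/asboolP; apply: SC_trans tr.
Qed.

Canonical sum_cong_equiv :=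
  EquivRel sum_congb sum_congb_refl sum_congb_sym sum_congb_trans.

Definition elhs_sum := {eq_quot sum_cong_equiv}%qT.
HB.instance Definition _ := Choice.on elhs_sum.
Implicit Types u v w : elhs_sum.

Definition sum_pi (s : sum_term) : elhs_sum := (\pi_elhs_sum s)%qT.

Lemma sum_piP s t : sum_pi s = sum_pi t <-> sum_cong s t.
Proof.
split; first by move=> /eqquotP/asboolP.
by move=> st; apply/eqquotP/asboolP.
Qed.

Lemma sum_pi_ex u : exists s, u = sum_pi s.
Proof. by exists (repr u); rewrite /sum_pi reprK. Qed.

Lemma sum_repr s : sum_cong (repr (sum_pi s)) s.
Proof. by apply/sum_piP; rewrite /sum_pi reprK. Qed.

Definition sum_meet u v : elhs_sum := sum_pi (TMeet (repr u) (repr v)).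
Definition sum_imp u v : elhs_sum := sum_pi (TImp (repr u) (repr v)).

Lemma sum_meetE s t : sum_meet (sum_pi s) (sum_pi t) = sum_pi (TMeet s t).
Proof. by apply/sum_piP; apply: SC_meet; apply: sum_repr. Qed.
Lemma sum_impE s t : sum_imp (sum_pi s) (sum_pi t) = sum_pi (TImp s t).
Proof. by apply/sum_piP; apply: SC_imp; apply: sum_repr. Qed.

Let sumA : associative sum_meet.
Proof.
move=> u v w.
have [s ->] := sum_pi_ex u; have [t ->] := sum_pi_ex v.
have [r ->] := sum_pi_ex w.
by rewrite !sum_meetE; apply/sum_piP; apply: SC_meetA.
Qed.
Let sumC : commutative sum_meet.
Proof.
move=> u v; have [s ->] := sum_pi_ex u; have [t ->] := sum_pi_ex v.
by rewrite !sum_meetE; apply/sum_piP; apply: SC_meetC.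
Qed.
Let sumxx : idempotent_op sum_meet.
Proof.
move=> u; have [s ->] := sum_pi_ex u.
by rewrite /idempotent_op !sum_meetE; apply/sum_piP; apply: SC_meetxx.
Qed.
Let sum1x : left_id (sum_pi TTop) sum_meet.
Proof.
move=> u; have [s ->] := sum_pi_ex u.
by rewrite !sum_meetE; apply/sum_piP; apply: SC_meet1x.
Qed.
Let sum_adj u v w :
  sum_meet (sum_meet u v) w = sum_meet u v <-> sum_meet u (sum_imp v w) = u.
Proof.
have [s ->] := sum_pi_ex u; have [t ->] := sum_pi_ex v.
have [r ->] := sum_pi_ex w.
rewrite !(sum_meetE, sum_impE) !sum_piP.
by split; [apply: SC_adj1 | apply: SC_adj2].
Qed.
Let sum_lin u v w :
  sum_meet (sum_imp (sum_imp u v) w) (sum_imp (sum_imp v u) w) = w.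
Proof.
have [s ->] := sum_pi_ex u; have [t ->] := sum_pi_ex v.
have [r ->] := sum_pi_ex w.
by rewrite !(sum_meetE, sum_impE); apply/sum_piP; apply: SC_lin.
Qed.

HB.instance Definition _ := @isELHSemilattice.Build elhs_display elhs_sum
  (sum_pi TTop) sum_meet sum_imp sumA sumC sumxx sum1x sum_adj sum_lin.

Definition elhs_inj1 : elhs_hom X elhs_sum.
Proof.
exists (fun x => sum_pi (TInl x)) => [|x y|x y].
- by apply/sum_piP; apply: SC_inl1.
- by rewrite [RHS]sum_meetE; apply/sum_piP; apply: SC_inlM.
- by rewrite [RHS]sum_impE; apply/sum_piP; apply: SC_inlI.
Defined.

Definition elhs_inj2 : elhs_hom Y elhs_sum.
Proof.
exists (fun y => sum_pi (TInr y)) => [|x y|x y].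
- by apply/sum_piP; apply: SC_inr1.
- by rewrite [RHS]sum_meetE; apply/sum_piP; apply: SC_inrM.
- by rewrite [RHS]sum_impE; apply/sum_piP; apply: SC_inrI.
Defined.

Section Copair.
Variables (Z : elhs) (f : elhs_hom X Z) (g : elhs_hom Y Z).

Fixpoint sum_eval (s : sum_term) : Z :=
  match s with
  | TInl x => f x
  | TInr y => g y
  | TTop => Order.top
  | TMeet s t => Order.meet (sum_eval s) (sum_eval t)
  | TImp s t => himp (sum_eval s) (sum_eval t)
  end.

Lemma sum_eval_cong s t : sum_cong s t -> sum_eval s = sum_eval t.
Proof.
elim=> {s t} //=.
- by move=> s t r _ -> _ ->.
- by move=> s s' t t' _ -> _ ->.
- by move=> s s' t t' _ -> _ ->.
- by move=> s t r; rewrite meetA.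
- by move=> s t; rewrite meetC.
- by move=> s; rewrite meetxx.
- by move=> s; rewrite meet1x.
- by move=> s t r _ /himp_meetE.
- by move=> s t r _ /himp_meetE.
- by move=> s t r; rewrite himp_lin.
- exact: elhs_fun1.
- by move=> x x'; rewrite elhs_funM.
- by move=> x x'; rewrite elhs_funI.
- exact: elhs_fun1.
- by move=> y y'; rewrite elhs_funM.
- by move=> y y'; rewrite elhs_funI.
Qed.

Lemma sum_eval_repr s : sum_eval (repr (sum_pi s)) = sum_eval s.
Proof. exact/sum_eval_cong/sum_repr. Qed.

Definition elhs_copair : elhs_hom elhs_sum Z.
Proof.
exists (fun u : elhs_sum => sum_eval (repr u)) => [|u v|u v].
- exact: sum_eval_repr.
- exact: sum_eval_repr.
- exact: sum_eval_repr.
Defined.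

End Copair.

Lemma elhs_sum_ext (Z : elhs) (h k : elhs_hom elhs_sum Z) :
  (forall x, h (elhs_inj1 x) = k (elhs_inj1 x)) ->
  (forall y, h (elhs_inj2 y) = k (elhs_inj2 y)) -> h = k.
Proof.
move=> h1 h2; apply: elhs_homP => u; have [s ->] := sum_pi_ex u.
elim: s => [x|y||s IHs t IHt|s IHs t IHt]; [exact: h1 | exact: h2 | | |].
- exact: etrans (elhs_fun1 h) (esym (elhs_fun1 k)).
- by rewrite -sum_meetE [LHS]elhs_funM [RHS]elhs_funM IHs IHt.
- by rewrite -sum_impE [LHS]elhs_funI [RHS]elhs_funI IHs IHt.
Qed.

End Coproduct.

Definition ELHSLat : ptCategory.
Proof.
apply: (@PtCategory ELHS_category (elhs_unit : elhs)
  elhs_to_unit elhs_from_unit _ _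
  (fun X Y => elhs_prod X Y : elhs) elhs_proj1 elhs_proj2
  (fun W X Y => @elhs_pair X Y W) _ _ _
  (fun X Y f g => @elhs_eqlz X Y f g : elhs) elhs_eqlzm
  (fun W X Y f g => @elhs_eqlz_lift X Y f g W) _ _ _
  (fun X Y => elhs_sum X Y : elhs) elhs_inj1 elhs_inj2 elhs_copair).
- by move=> X f; apply: elhs_homP => x; apply: unitE.
- move=> X f; apply: elhs_homP => x.
  by rewrite (unitE x Order.top) !elhs_fun1.
- by move=> W X Y f g; apply: elhs_homP.
- by move=> W X Y f g; apply: elhs_homP.
- by move=> W X Y h; apply: elhs_homP => w /=; case: (h w).
- by move=> X Y f g; apply: elhs_homP => u; apply/eqP/(valP u).
- by move=> W X Y f g h e; apply: elhs_homP.
- move=> W X Y f g h k e; apply: elhs_homP => w; apply: val_inj.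
  exact: (congr1 (fun m : elhs_hom W X => m w) e).
- by move=> X Y Z f g; apply: elhs_homP => x; apply: sum_eval_repr.
- by move=> X Y Z f g; apply: elhs_homP => y; apply: sum_eval_repr.
- move=> X Y Z h; apply: elhs_sum_ext => x /=.
  + by rewrite sum_eval_repr.
  + by rewrite sum_eval_repr.
Defined.

(* The categorical kernel in ELHSLat is the inclusion of the preimage of 1. *)
Lemma ELHSLat_ker (X Y : elhs) (f : elhs_hom X Y) (x : X) :
  (exists u : (kerob (f : @hom ELHSLat X Y) : elhs),
     (kerm (f : @hom ELHSLat X Y) : elhs_hom _ _) u = x) <->
  f x = Order.top.
Proof.
split=> [[u <-]|fx]; first exact/eqP/(valP u).
by exists (exist (fun x : X => _ x == _ x) x (introT eqP fx)).
Qed.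

(* Main.v *)
Require Import Defs.
From HB Require Import structures.
From mathcomp Require Import all_boot all_order zify.

(** The comparison morphism is not surjective when [X], [Y] and [Z] are all
    the two-element chain, which is free on one generator.

    Write [x], [y], [z] for the generators of [X + Y + Z], and value them in a
    chain.  If [x < y < 1], an element [b] of the cosmash product of [X] and
    [Y] can only take the values [y] and [1]: collapsing [y] to [1] must send
    [b] to [1], whereas it leaves [x] below [1].  Which of the two values [b]
    takes depends only on the order of [x] and [y]; hence lowering [x] does not
    change [b] ([cosmash_lower]).  An element in the image of the comparison
    morphism is built from such elements [b] and from [z], so it has the same
    value when [z < x < y] as when [x < z < y] ([cosmash2m_lower]).

    The element [(z -> x) -> w], where [w = (z -> u) -> u] and
    [u = (x -> y) -> y], does distinguish the two cases: [w] equals [y] in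
    both, so the value is [y] when [z < x < y] and [1] when [x < z < y].  On
    the other hand [w] becomes [1] as soon as one generator is sent to [1], so
    the element belongs to the ternary cosmash product. *)

Set Implicit Arguments.
Unset Strict Implicit.
Unset Printing Implicit Defensive.

Import Order.TTheory.
Local Open Scope cat_scope.

(** * Heyting semilattices and their coproducts *)

Section Himp.
Variable H : elhs.
Implicit Types x y z : H.

Lemma himpxx x : himp x x = Order.top.
Proof. by apply/eqP; rewrite eq_le lex1 -lexhimp leIr. Qed.

Lemma himpx1 x : himp x Order.top = Order.top.
Proof. by apply/eqP; rewrite eq_le lex1 -lexhimp lex1. Qed.

Lemma himp1x x : himp Order.top x = x.
Proof.
apply/eqP; rewrite eq_le -lexhimp leIl andbT.
by have := lexx (himp Order.top x); rewrite -lexhimp meetx1.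
Qed.

(** The element [himp (himp x y) y] is an upper bound of [x] and [y]; repeating
    the construction with [z] gives an expression that is [1] as soon as one
    argument is. The premise [himp z x] is what tells
    [z < x] from [x < z]. *)
Definition separator x y z : H :=
  let u := himp (himp x y) y in himp (himp z x) (himp (himp z u) u).

Lemma separator1 x y z :
  x = Order.top \/ y = Order.top \/ z = Order.top ->
  separator x y z = Order.top.
Proof.
by rewrite /separator => -[|[|]] ->; rewrite !(himp1x, himpxx, himpx1).
Qed.

End Himp.

Lemma separator_morph (H K : elhs) (f : elhs_hom H K) x y z :
  f (separator x y z) = separator (f x) (f y) (f z).
Proof. by rewrite /separator !elhs_funI. Qed.

Section CopairElements.
Variables (X Y Z : elhs) (f : elhs_hom X Z) (g : elhs_hom Y Z).

Lemma elhs_copair1 x : elhs_copair f g (elhs_inj1 X Y x) = f x.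
Proof. exact: sum_eval_repr. Qed.

Lemma elhs_copair2 y : elhs_copair f g (elhs_inj2 X Y y) = g y.
Proof. exact: sum_eval_repr. Qed.

End CopairElements.

(** * The two-element chain *)

Definition two := bool.
HB.instance Definition _ := Choice.on two.

Lemma two_adj (x y z : two) :
  (x && y) && z = x && y <-> x && (y ==> z) = x.
Proof. by case: x y z => [] [] []. Qed.

Lemma two_lin (x y z : two) :
  ((x ==> y) ==> z) && ((y ==> x) ==> z) = z.
Proof. by case: x y z => [] [] []. Qed.

HB.instance Definition _ := @isELHSemilattice.Build elhs_display two
  true andb implb andbA andbC andbb andTb two_adj two_lin.

(** The two-element chain is free on [false], so this is the morphism that picks
    out [a]. *)
Definition point (H : elhs) (a : H) : elhs_hom two H.
Proof.
exists (fun b : two => if b then Order.top else a) => [//|[] []|[] []].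
all: by rewrite ?(meetxx, meetx1, meet1x, himpxx, himpx1, himp1x).
Defined.

Lemma two_hom_ext (H : elhs) (f g : elhs_hom two H) :
  f false = g false -> f = g.
Proof.
move=> fg; apply: elhs_homP => -[] //.
by rewrite [LHS]elhs_fun1 [RHS]elhs_fun1.
Qed.

(** * An infinite descending chain *)

(** The natural numbers with the reverse order: [0] is the top element. Its
    morphisms include every strictly increasing function that fixes [0], so
    values can be lowered without moving the ones above them. *)
Definition depth := nat.
HB.instance Definition _ := Choice.on depth.

Definition depth_imp (m n : depth) : depth := if n <= m then 0 else n.

Lemma depth_adj (m n k : depth) :
  maxn (maxn m n) k = maxn m n <-> maxn m (depth_imp n k) = m.
Proof. by rewrite /depth_imp; case: (leqP k n); lia. Qed.

Lemma depth_lin (m n k : depth) :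
  maxn (depth_imp (depth_imp m n) k) (depth_imp (depth_imp n m) k) = k.
Proof.
rewrite /depth_imp.
by case: (leqP n m) (leqP m n) => ? [] ?; rewrite ?leqn0; repeat case: ifP; lia.
Qed.

HB.instance Definition _ := @isELHSemilattice.Build elhs_display depth
  0 maxn depth_imp maxnA maxnC maxnn max0n depth_adj depth_lin.

(** Identifies [1] with the top element [0]. *)
Definition depth_pred : elhs_hom depth depth.
Proof.
exists (fun n : depth => n.-1 : depth) => [//|m n|m n].
  by rewrite /Order.meet /=; lia.
by rewrite /himp /= /depth_imp; repeat case: ifP; lia.
Defined.

(** Makes room for two values between [1] and the images of the others. *)
Definition depth_lower : elhs_hom depth depth.
Proof.
exists (fun n : depth => (if n <= 1 then n else n.+2) : depth) => [//|m n|m n].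
  by rewrite /Order.meet /=; repeat case: ifP; lia.
by rewrite /himp /= /depth_imp; repeat case: ifP; lia.
Defined.

(** * Values of cosmash products in the descending chain *)

Definition twoL : ELHSLat := (two : elhs).
Definition depthL : ELHSLat := (depth : elhs).

Definition value (n : depth) : hom twoL depthL := point n.

(** The morphism [depth_lower] lowers [x] from [2] to [4] while fixing [y] at
    [1]. It fixes the values of elements of the cosmash product because these
    are at most [1], which in turn is seen by composing with [depth_pred]. *)
Lemma cosmash_lower :
  copair (value 2) (value 1) \c cosmashm twoL twoL =
  copair (value 4) (value 1) \c cosmashm twoL twoL.
Proof.
pose lower : hom depthL depthL := depth_lower.
pose pred : hom depthL depthL := depth_pred.
have -> : copair (value 4) (value 1) = lower \c copair (value 2) (value 1).
  by rewrite copair_comp; congr copair; apply: two_hom_ext.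
rewrite -compmA; set e := _ \c cosmashm _ _.
have e0 : pred \c e = zerom _ _.
  rewrite /e compmA copair_comp.
  have -> : pred \c value 1 = zerom twoL depthL by apply: two_hom_ext.
  exact: cosmash_copair0.
apply: elhs_homP => b.
have {e0} /= := congr1 (fun h : elhs_hom _ depth => h b) e0.
have lowerE (n : depth) : n.-1 = 0 -> n = depth_lower n.
  by rewrite /=; case: ifP; lia.
exact: lowerE.
Qed.

Definition value3 (m n k : depth) : hom (sumo (sumo twoL twoL) twoL) depthL :=
  copair (copair (value m) (value n)) (value k).

(** The value [3] of [z] lies strictly between the values [2] and [4] of [x], so
    that [z < x < y] on the left and [x < z < y] on the right. *)
Lemma cosmash2m_lower :
  value3 2 1 3 \c cosmash2m twoL twoL twoL =
  value3 4 1 3 \c cosmash2m twoL twoL twoL.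
Proof.
rewrite /cosmash2m !compmA !copair_comp /value3 !compmA.
rewrite !copair_inj1 !copair_inj2.
by rewrite cosmash_lower.
Qed.

(** * An element outside the image of the comparison morphism *)

Notation sum3 := (elhs_sum (elhs_sum two two) two).

Definition gen1 : sum3 := elhs_inj1 _ _ (elhs_inj1 two two false).
Definition gen2 : sum3 := elhs_inj1 _ _ (elhs_inj2 two two false).
Definition gen3 : sum3 := elhs_inj2 (elhs_sum two two) two false.
Definition sep : sum3 := separator gen1 gen2 gen3.

Lemma value3_sep m n k :
  (value3 m n k : elhs_hom _ _) sep = separator (m : depth) n k.
Proof.
by rewrite separator_morph /gen1 /gen2 /gen3 !(elhs_copair1, elhs_copair2).
Qed.

Lemma sep_cosmash3 :
  exists u : (cosmash3 twoL twoL twoL : elhs),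
    (cosmash3m twoL twoL twoL : elhs_hom _ _) u = sep.
Proof.
apply/ELHSLat_ker.
have kill (H : elhs) (f : elhs_hom sum3 H) :
    f gen1 = Order.top \/ f gen2 = Order.top \/ f gen3 = Order.top ->
    f sep = Order.top.
  by rewrite separator_morph; apply: separator1.
have k3 := @kill _ (kill3 twoL twoL twoL).
have k2 := @kill _ (kill2 twoL twoL twoL).
have k1 := @kill _ (kill1 twoL twoL twoL).
rewrite /gen1 /gen2 /gen3 !(elhs_copair1, elhs_copair2) in k1 k2 k3.
by congr ((_, _), _); [apply: k3 | apply: k2 | apply: k1]; intuition.
Qed.

Theorem theorem6p1 : ~ cosmash_associative ELHSLat.
Proof.
move=> assoc; have [g [_ cg]] := assoc twoL twoL twoL.
have [u uE] := sep_cosmash3.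
have comparisonK :
    cosmash2m twoL twoL twoL \c g = cosmash3m twoL twoL twoL.
  have <- : cosmash3m _ _ _ \c cosmash_comparison twoL twoL twoL
            = cosmash2m twoL twoL twoL by exact: eqlz_liftK.
  by rewrite -compmA cg compm1.
have lowerE : value3 2 1 3 \c cosmash3m twoL twoL twoL =
              value3 4 1 3 \c cosmash3m twoL twoL twoL.
  by rewrite -comparisonK compmA cosmash2m_lower compmA.
have valueE m n k : separator (m : depth) n k =
    (value3 m n k \c cosmash3m twoL twoL twoL : elhs_hom _ _) u.
  by rewrite -value3_sep -uE.
(* the two values are [1], the image of [y], and the top element [0] *)
have : separator (2 : depth) 1 3 = separator (4 : depth) 1 3.
  by rewrite !valueE lowerE.
by [].
Qed.
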